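(* Assume $w,\mathbf x,y,\pi$ are continuously differentiable and $\boldsymbol\theta$ is a continuous random variable. Fix a current policy parameter $\hat{\boldsymbol\beta}\in\mathbb R^k$. Draw $n$ agents with i.i.d. types $\boldsymbol\theta_1,\dots,\boldsymbol\theta_n\sim G$ and, independently, i.i.d. vectors $\boldsymbol\epsilon_i$ uniform on $\{-1,1\}^k$. Agent $i$ is announced $\boldsymbol\beta_i=\hat{\boldsymbol\beta}+h\boldsymbol\epsilon_i$, reports $\mathbf X_i=\mathbf x(\boldsymbol\beta_i,\boldsymbol\theta_i)$, is treated with $W_i=w(\mathbf X_i;\boldsymbol\beta_i)$, has outcome $Y_i=y(W_i,\boldsymbol\theta_i)$, and yields $\pi_i=\pi(W_i,Y_i)$. Let $\mathbf Q$ be the $n\times k$ matrix with rows $h\boldsymbol\epsilon_i'$, $\boldsymbol\pi=(\pi_1,\dots,\pi_n)'$, and $\hat{\boldsymbol\Gamma}=(\mathbf Q'\mathbf Q)^{-1}\mathbf Q'\boldsymbol\pi$ (the OLS coefficient of $\boldsymbol\pi$ on $\mathbf Q$). If the perturbation size is $h=c\,n^{-\alpha}$ for a constant $c>0$ and $0<\alpha<1/2$, then for every $\epsilon>0$, $$\lim_{n\to\infty}\mathbb P\left(\big|\hat{\boldsymbol\Gamma}-\nabla\Pi(\hat{\boldsymbol\beta})\big|>\epsilon\right)=0.$$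
   Context: Model: each individual has an unobserved type $\boldsymbol\theta\in\Theta$, drawn i.i.d. from a distribution $G$ unknown to the planner. The planner announces a parameter $\boldsymbol\beta\in\mathbb R^k$ of a known treatment rule $w:\mathbb R^{d_x}\times\mathbb R^k\to\mathbb R$. An individual of type $\boldsymbol\theta$ facing $\boldsymbol\beta$ reports pre-treatment characteristics $\mathbf X=\mathbf x(\boldsymbol\beta,\boldsymbol\theta)\in\mathbb R^{d_x}$ (unknown to the planner), receives treatment $W=w(\mathbf X;\boldsymbol\beta)$, and has outcome $Y=y(W,\boldsymbol\theta)$. The per-individual objective is $\pi(W,Y)$ for a known $\pi$, and the planner objective is $\Pi(\boldsymbol\beta)=\mathbb E_{\boldsymbol\theta\sim G}[\pi(W,y(W,\boldsymbol\theta))]$ with $W=w(\mathbf x(\boldsymbol\beta,\boldsymbol\theta);\boldsymbol\beta)$.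
   Formalization: Two conditions are added: the second moment of π(W,Y) is bounded uniformly for β near β̂, and Π is differentiable at β̂; without the first the claim fails, e.g. for π=Y=θ symmetric with finite mean, infinite variance and α near 1/2. *)

(* Defs.v *)
From HB Require Import structures.
From mathcomp Require Import all_boot all_order all_algebra.
From mathcomp Require Import all_classical all_reals all_analysis.
Set Implicit Arguments. Unset Strict Implicit. Unset Printing Implicit Defensive.
Import Order.TTheory GRing.Theory Num.Theory.
Import numFieldNormedType.Exports.
Local Open Scope classical_set_scope.
Local Open Scope ring_scope.

(* Continuously differentiable map between normed spaces:
   differentiable everywhere, and every directional derivative x |-> 'D_v f x
   is continuous (equivalent to C^1 in finite dimension). *)
Definition C1 (R : realType) (V W : normedModType R) (f : V -> W) : Prop :=
  (forall a, differentiable f a) /\ (forall v : V, continuous (fun a => 'D_v f a)).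

Definition euclid (R : realType) (m n : nat) (v : 'M[R]_(m, n)) : R :=
  Num.sqrt (\sum_i \sum_j v i j ^+ 2).

(* A sign pattern in {-1,1}^k, encoded by booleans (true = +1, false = -1). *)
Definition signs (k : nat) := {ffun 'I_k -> bool}.
Definition sgnvec (R : realType) (k : nat) (s : signs k) : 'rV[R]_k :=
  \row_j (if s j then 1 else -1).

Definition pobj (R : realType) (k dx dt : nat)
  (w : 'rV[R]_dx -> 'rV[R]_k -> R) (x : 'rV[R]_k -> 'rV[R]_dt -> 'rV[R]_dx)
  (y : R -> 'rV[R]_dt -> R) (piF : R -> R -> R)
  (beta : 'rV[R]_k) (theta : 'rV[R]_dt) : R :=
  let W := w (x beta theta) beta in piF W (y W theta).

Definition Pi (R : realType) (d : measure_display) (Omega : measurableType d)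
  (P : probability Omega R) (k dx dt : nat)
  w x y piF (theta0 : Omega -> 'rV[R]_dt) (beta : 'rV[R]_k) : R :=
  fine (\int[P]_om (@pobj R k dx dt w x y piF beta (theta0 om))%:E).

Definition grad (R : realType) (k : nat) (f : 'rV[R]_k -> R) (b : 'rV[R]_k)
  : 'cV[R]_k := \col_j ('D_(delta_mx 0 j) f b).

Definition in_box (R : realType) (T : Type) (dt : nat)
  (th : T -> 'rV[R]_dt) (A : 'I_dt -> set R) : set T :=
  [set om | forall j, A j (th om 0 j)].

(* Mutual independence of the family (theta_i, eps_i)_{i in nat}: the product
   rule over every finite initial segment, for boxes (which generate the Borel
   sigma-algebra of R^dt and form a pi-system) and arbitrary sets of sign
   patterns.  Taking full sets covers every finite subfamily. *)
Definition indep_family (R : realType) (d : measure_display)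
  (Omega : measurableType d) (P : probability Omega R) (k dt : nat)
  (theta : nat -> Omega -> 'rV[R]_dt) (eps : nat -> Omega -> signs k) : Prop :=
  forall (n : nat) (A : nat -> 'I_dt -> set R) (B : nat -> set (signs k)),
    (forall i j, measurable (A i j)) ->
    P (\bigcap_(i in [set i | (i < n)%N])
         (in_box (theta i) (A i) `&` (eps i @^-1` B i)))
    = (\prod_(i < n) (P (in_box (theta i) (A i)) * P (eps i @^-1` B i)))%E.

(* Main.v *)
Require Import Defs.
From HB Require Import structures.
From mathcomp Require Import all_boot all_order all_algebra.
From mathcomp Require Import all_classical all_reals all_analysis.
From mathcomp Require Import measurable_realfun ring lra.
Set Implicit Arguments. Unset Strict Implicit. Unset Printing Implicit Defensive.
Import Order.TTheory GRing.Theory Num.Theory.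
Import numFieldNormedType.Exports.
Local Open Scope classical_set_scope.
Local Open Scope ring_scope.

(** With [S = Q'Q / (n h^2)] and [g = Q'pi / (n h^2)], the OLS coefficient solves
    [S Gamma = g].  The entries of [S] and [g] are averages of i.i.d. terms.  Those
    of [S] have mean [delta_jl] and bounded variance; those of [g] have mean
    [2^-k sum_s s_j Pi (betahat + h s) / h], which tends to the [j]-th partial
    derivative of [Pi], and variance [O(1 / (n h^2))], which vanishes since
    [alpha < 1/2].  Chebyshev's inequality gives convergence in probability of [S]
    and [g], and solving a linear system close to the identity is stable.  The laws
    and the independence, given on boxes only, extend to the generated
    sigma-algebras by the pi-lambda theorem. *)

(** * Weak law of large numbers under pairwise independence, with an explicit bound *)

Section pairwise_independent_average.
Local Open Scope ereal_scope.
Context (d : measure_display) (Omega : measurableType d) (R : realType)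
  (P : probability Omega R).

(** The law of the pair [(X, Y)] and the product of the two laws agree on rectangles, hence
    everywhere, and Fubini splits the integral of the product. Square integrability makes [X \* Y]
    integrable. *)
Lemma expectationM_indep (X Y : Omega -> R) :
  X \in Lfun P 2%:E -> Y \in Lfun P 2%:E ->
  (forall A B : set R, measurable A -> measurable B ->
     P (X @^-1` A `&` Y @^-1` B) = P (X @^-1` A) * P (Y @^-1` B)) ->
  'E_P[(X \* Y)%R] = 'E_P[X] * 'E_P[Y].
Proof.
move=> X2 Y2 XY.
have Pfin : P setT \is a fin_num := fin_num_measure P _ measurableT.
have X1 := Lfun_subset12 Pfin X2.
have Y1 := Lfun_subset12 Pfin Y2.
have XY1 := Lfun2_mul_Lfun1 X2 Y2.
have mX : measurable_fun setT X by move/sub_Lfun_mfun: X2; rewrite inE.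
have mY : measurable_fun setT Y by move/sub_Lfun_mfun: Y2; rewrite inE.
pose X' : {RV P >-> R} := HB.pack X (isMeasurableFun.Build _ _ _ _ X mX).
pose Y' : {RV P >-> R} := HB.pack Y (isMeasurableFun.Build _ _ _ _ Y mY).
have mXY : measurable_fun setT (fun w => (X w, Y w)).
  exact/measurable_fun_pair.
pose Z' : {RV P >-> (R * R)%type} :=
  HB.pack (fun w => (X w, Y w)) (isMeasurableFun.Build _ _ _ _ _ mXY).
pose f (z : R * R) : \bar R := (z.1 * z.2)%:E.
have mf : measurable_fun [set: R * R] f.
  by apply/measurable_EFinP; apply: measurable_funM.
have /Lfun1_integrable iXY := XY1.
have /Lfun1_integrable iX := X1.
have /Lfun1_integrable iY := Y1.
have ZE (A : set (R * R)) : measurable A ->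
    (distribution P X' \x distribution P Y') A = distribution P Z' A.
  by apply: product_measure_unique => A' B' mA' mB'; rewrite -XY.
have iZ : (distribution P Z').-integrable setT f.
  exact: (@integrable_pushforward _ _ _ _ _ _ mXY P setT f).
have iprod : (distribution P X' \x distribution P Y').-integrable setT f.
  move/integrableP: iZ => [_ fin]; apply/integrableP; split => //.
  rewrite (eq_measure_integral (distribution P Z'))// => A mA _; exact: ZE.
rewrite unlock.
transitivity (\int[distribution P Z']_z f z).
  by rewrite integral_distribution.
rewrite (eq_measure_integral (distribution P X' \x distribution P Y')); last first.
  by move=> A mA _; exact/esym/ZE.
rewrite -integral12_prod_meas1// /fubini_F /f/=.
have iYd : (distribution P Y').-integrable setT (EFin : R -> \bar R).
  exact: (@integrable_pushforward _ _ _ _ _ _ mY P setT EFin).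
have iXd : (distribution P X').-integrable setT (EFin : R -> \bar R).
  exact: (@integrable_pushforward _ _ _ _ _ _ mX P setT EFin).
have EYE : \int[distribution P Y']_y y%:E = \int[P]_w (Y w)%:E.
  by rewrite integral_distribution.
have EXE : \int[distribution P X']_y y%:E = \int[P]_w (X w)%:E.
  by rewrite integral_distribution.
have EYfin : \int[P]_w (Y w)%:E \is a fin_num by exact: integrable_fin_num.
rewrite -EXE -(fineK EYfin) -(integralZr measurableT iXd).
apply: eq_integral => x _; rewrite (fineK EYfin) -EYE.
rewrite -(integralZl measurableT iYd).
by apply: eq_integral => y _; rewrite EFinM.
Qed.

(** By induction each new term is uncorrelated with the partial sum before it. Square integrability
    of the sum is part of the conclusion because the rule for scaled variances asks for it. *)
Lemma variance_sum_uncorrelated (X : nat -> Omega -> R) (n : nat) :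
  (forall i, X i \in Lfun P 2%:E) ->
  (forall i j, (i < j)%N -> covariance P (X i) (X j) = 0) ->
  (\sum_(i < n) X i)%R \in Lfun P 2%:E /\
  'V_P[(\sum_(i < n) X i)%R] = \sum_(i < n) 'V_P[X i].
Proof.
move=> X2 cov.
have S2 m : (\sum_(i < m) X i)%R \in Lfun P 2%:E.
  elim: m => [|m IH]; first by rewrite big_ord0; exact: (Lfun_cst _ 0%R).
  by rewrite big_ord_recr; apply: rpredD => //; rewrite lee1n.
split => //.
have covS m j : (m <= j)%N -> covariance P (\sum_(i < m) X i)%R (X j) = 0.
  elim: m => [|m IH] mj; first by rewrite big_ord0 (covariance_cst_l P 0%R).
  rewrite big_ord_recr covarianceDl// (IH (ltnW mj)) cov//.
  by rewrite adde0.
elim: n => [|n IH]; first by rewrite !big_ord0 (variance_cst P 0%R).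
by rewrite !big_ord_recr varianceD// IH covS// mule0 adde0.
Qed.

Lemma sqr_integrable_Lfun2 (X : Omega -> R) : measurable_fun setT X ->
  \int[P]_w (X w ^+ 2)%:E < +oo -> X \in Lfun P 2%:E.
Proof.
move=> mX foo; rewrite inE; apply/andP; split; rewrite inE//=.
rewrite /finite_norm unlock/= poweR_lty//.
under eq_integral => w _.
  rewrite powR_mulrn// real_normK ?num_real//.
  over.
exact: foo.
Qed.

(** Chebyshev's inequality for the average. The bound is explicit in [n] and [V], not a limit,
    because [f] will itself change with [n]. Law and independence are assumed of [Z], so one set of
    hypotheses serves every [f]. *)
Lemma weak_lln (d' : measure_display) (T : measurableType d') (Z : nat -> Omega -> T)
    (f : T -> R) (V delta : R) (n : nat) :
  (forall i, measurable_fun setT (Z i)) ->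
  (forall i (A : set T), measurable A -> P (Z i @^-1` A) = P (Z 0%N @^-1` A)) ->
  (forall i j (A B : set T), (i < j)%N -> measurable A -> measurable B ->
     P (Z i @^-1` A `&` Z j @^-1` B) = P (Z i @^-1` A) * P (Z j @^-1` B)) ->
  measurable_fun setT f ->
  \int[P]_w (f (Z 0%N w) ^+ 2)%:E <= V%:E ->
  (0 < n)%N -> (0 < delta)%R ->
  P [set w | (delta <= `|n%:R^-1 * (\sum_(i < n) f (Z i w))
                         - fine (\int[P]_w (f (Z 0%N w))%:E)|)%R]
    <= (V / (n%:R * delta ^+ 2))%:E.
Proof.
move=> mZ idZ indZ mf fV n0 delta0.
have mfZ i : measurable_fun setT (f \o Z i) by exact: measurableT_comp.
have distrZ (g : T -> \bar R) i : measurable_fun setT g -> (forall t, 0 <= g t) ->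
    \int[P]_w g (Z i w) = \int[P]_w g (Z 0%N w).
  move=> mg g0.
  rewrite -(@ge0_integral_pushforward _ _ _ _ _ (Z i) (mZ i) P setT g)//.
  rewrite -(@ge0_integral_pushforward _ _ _ _ _ (Z 0%N) (mZ 0%N) P setT g)//.
  by apply: eq_measure_integral => A mA _; exact: idZ.
have Vi i : \int[P]_w (f (Z i w) ^+ 2)%:E <= V%:E.
  rewrite (distrZ (fun t => (f t ^+ 2)%:E) i)//; last first.
    by move=> t; rewrite lee_fin sqr_ge0.
  by apply/measurable_EFinP; exact: measurable_funX.
have X2 i : f \o Z i \in Lfun P 2%:E.
  by apply: sqr_integrable_Lfun2 => //; exact: le_lt_trans (Vi i) (ltry _).
have Pfin : P setT \is a fin_num := fin_num_measure P _ measurableT.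
have X1 i := Lfun_subset12 Pfin (X2 i).
have EX i : 'E_P[f \o Z i] = 'E_P[f \o Z 0%N].
  have /Lfun1_integrable iXi := X1 i.
  have /Lfun1_integrable iX0 := X1 0%N.
  rewrite unlock.
  rewrite -(@integral_pushforward _ _ _ _ _ (Z i) (mZ i) P setT (EFin \o f))//.
  2: exact/measurable_EFinP.
  rewrite -(@integral_pushforward _ _ _ _ _ (Z 0%N) (mZ 0%N) P setT (EFin \o f))//.
  2: exact/measurable_EFinP.
  by apply: eq_measure_integral => A mA _; exact: idZ.
have cov i j : (i < j)%N -> covariance P (f \o Z i) (f \o Z j) = 0.
  move=> ij; rewrite covarianceE//; last exact: Lfun2_mul_Lfun1.
  rewrite expectationM_indep// ?subee// ?fin_numM ?expectation_fin_num//.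
  move=> A B mA mB.
  apply: (indZ _ _ (f @^-1` A) (f @^-1` B)) => //.
    by rewrite -[_ @^-1` _]setTI; exact: mf.
  by rewrite -[_ @^-1` _]setTI; exact: mf.
have [S2 VS] := @variance_sum_uncorrelated (fun i => f \o Z i) n X2 cov.
have mS : measurable_fun setT (n%:R^-1 \o* (\sum_(i < n) (f \o Z i)))%R.
  move/sub_Lfun_mfun: S2; rewrite inE => mS.
  by apply: (measurable_funM mS).
pose S : {RV P >-> R} := HB.pack (n%:R^-1 \o* (\sum_(i < n) (f \o Z i)))%R
  (isMeasurableFun.Build _ _ _ _ (n%:R^-1 \o* (\sum_(i < n) (f \o Z i)))%R mS).
have ES : 'E_P[S] = 'E_P[f \o Z 0%N].
  rewrite /S/= expectationZl ?(Lfun_subset12 Pfin)//.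
  have -> : (\sum_(i < n) (f \o Z i))%R = (\sum_(Xi <- [seq f \o Z i | i <- index_iota 0 n]) Xi)%R.
    by rewrite big_map big_mkord.
  rewrite expectation_sum; last by move=> Xi /mapP[i _ ->].
  rewrite big_map; under eq_bigr do rewrite EX.
  rewrite big_mkord.
  rewrite -(fineK (expectation_fin_num (X1 0%N))) sumEFin sumr_const card_ord.
  rewrite -EFinM -(mulr_natl (fine 'E_P[f \o Z 0%N]) n) mulrA.
  by rewrite mulVf ?mul1r// pnatr_eq0 -lt0n.
have := @chebyshev _ _ _ P S delta delta0.
rewrite ES.
have -> : fine 'E_P[f \o Z 0%N] = fine (\int[P]_w (f (Z 0%N w))%:E).
  by rewrite unlock.
have -> : [set w | (delta <= `|S w - fine (\int[P]_w (f (Z 0%N w))%:E)|)%R] =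
  [set w | (delta <= `|n%:R^-1 * (\sum_(i < n) f (Z i w))
                         - fine (\int[P]_w (f (Z 0%N w))%:E)|)%R].
  by apply: eq_set => w; rewrite /S/= fct_sumE mulrC.
move=> /le_trans; apply.
rewrite /S/= varianceZ// VS.
(* The variance is the second moment minus a square. *)
have VXi i : 'V_P[f \o Z i] <= V%:E.
  rewrite varianceE//; apply: (@le_trans _ _ 'E_P[(f \o Z i) ^+ 2]%R); last first.
    by rewrite unlock; exact: Vi.
  rewrite -{1}[X in X - _]adde0 leeBlDr ?fin_numX ?expectation_fin_num//.
  by rewrite leeD2l// -(fineK (expectation_fin_num (X1 i))) -EFin_expe lee_fin sqr_ge0.
have VSle : \sum_(i < n) 'V_P[f \o Z i] <= (n%:R * V)%:E.
  have -> : (n%:R * V)%:E = \sum_(i < n) V%:E :> \bar R.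
    by rewrite sumEFin sumr_const card_ord mulr_natl.
  by apply: lee_sum => i _; exact: VXi.
have n0' : (n%:R != 0 :> R)%R by rewrite pnatr_eq0 -lt0n.
rewrite muleA -EFinM.
have -> : (V / (n%:R * delta ^+ 2))%:E =
    (delta ^- 2 * n%:R^-1 ^+ 2)%:E * (n%:R * V)%:E :> \bar R.
  by rewrite -EFinM; congr EFin; field; rewrite n0' gt_eqF.
apply: lee_wpmul2l => //.
by rewrite lee_fin mulr_ge0// ?invr_ge0 ?sqr_ge0.
Qed.

End pairwise_independent_average.

(** * Measurability of continuous functions of random vectors *)

Section continuous_images_of_random_vectors.
Context (R : realType) (m : nat).

Lemma rational_ball_cover (U : set 'rV[R]_m) (v : 'rV[R]_m) : open U -> U v ->
  exists (q : 'rV[rat]_m) (n : nat),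
    (ball (map_mx ratr q : 'rV[R]_m) n.+1%:R^-1 `<=` U) /\
    ball (map_mx ratr q : 'rV[R]_m) n.+1%:R^-1 v.
Proof.
move=> oU Uv.
have /nbhs_ballP[e /= e0 eU] : nbhs v U by exact: open_nbhs_nbhs.
(* With a radius below [e / 2], every point of a rational ball containing [v] is within [e] of
   [v]. *)
have /ltr_add_invr[n] : 0 < e / 2 by rewrite divr_gt0.
rewrite add0r => ne.
have n0 : 0 < n.+1%:R^-1 :> R by rewrite invr_gt0.
have qP (j : 'I_m) : exists q : rat, ball (ratr q : R) n.+1%:R^-1 (v 0 j).
  have /rat_in_itvoo[q] : v 0 j - n.+1%:R^-1 < v 0 j + n.+1%:R^-1 :> R.
    by rewrite ltrD2l (lt_trans _ n0)// oppr_lt0.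
  rewrite in_itv/= => /andP[q1 q2]; exists q.
  by apply: ball_sym; rewrite ball_itv/= in_itv/= q1 q2.
pose qf j := projT1 (cid (qP j)).
have vq : ball (map_mx ratr (\row_j qf j) : 'rV[R]_m) n.+1%:R^-1 v.
  split => // i j; rewrite ord1 !mxE; exact: (projT2 (cid (qP j))).
exists (\row_j qf j), n; split => // u uq.
apply: eU; apply: (@le_ball _ _ _ (n.+1%:R^-1 + n.+1%:R^-1)); first by rewrite (splitr e) lerD// ltW.
by apply: ball_triangle uq; exact: ball_sym.
Qed.

(** Measurability of [th] is known coordinatewise only. An open set is a countable union of balls
    with rational centres and radii [1 / (n + 1)], and a ball of the sup norm is a box. *)
Lemma measurable_continuous_rV (d : measure_display) (T : measurableType d)
    (f : 'rV[R]_m -> R) (th : T -> 'rV[R]_m) :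
  continuous f -> (forall j, measurable_fun setT (fun t => th t 0 j)) ->
  measurable_fun setT (f \o th).
Proof.
move=> cf mth; apply: (measurability _ (RGenOInfty.measurableE R)).
move=> _ [_ [a ->] <-]; rewrite setTI.
set U := f @^-1` `]a, +oo[%classic.
have oU : open U by move/continuousP: cf; apply; exact: rray_open.
pose F (qn : 'rV[rat]_m * nat) : set T :=
  if `[< ball (map_mx ratr qn.1 : 'rV[R]_m) qn.2.+1%:R^-1 `<=` U >]
  then th @^-1` ball (map_mx ratr qn.1 : 'rV[R]_m) qn.2.+1%:R^-1 else set0.
have -> : (f \o th) @^-1` `]a, +oo[%classic = \bigcup_qn F qn.
  apply/seteqP; split => [t Ut|t [[q n] _]].
    have [q [n [qU qt]]] := rational_ball_cover oU Ut.
    by exists (q, n) => //; rewrite /F asboolT.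
  by rewrite /F; case: asboolP => //= sub /sub.
apply: countable_bigcupT_measurable; first exact: countableP.
move=> [q n]; rewrite /F.
case: asboolP => // _ /=.
have -> : th @^-1` ball (map_mx ratr q : 'rV[R]_m) n.+1%:R^-1 =
    \bigcap_(j in [set: 'I_m]) ((fun t => th t 0 j) @^-1` ball (ratr (q 0 j) : R) n.+1%:R^-1).
  apply/seteqP; split => [t [_ qt] j _|t qt] /=.
    by have := qt 0 j; rewrite mxE.
  split; first by rewrite invr_gt0.
  by move=> i j; rewrite ord1 mxE; exact: qt.
apply: fin_bigcap_measurable => // j _; rewrite -[_ @^-1` _]setTI.
by apply: mth => //; exact: measurable_ball.
Qed.

End continuous_images_of_random_vectors.

(** * Extension of laws and independence from a pi-system *)

Section independence_from_generators.
Local Open Scope ereal_scope.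
Context (d d' : measure_display) (Omega : measurableType d) (T : measurableType d')
  (R : realType) (P : probability Omega R) (G : set (set T)).
Hypotheses (mG : measurable = <<s G >>) (GI : setI_closed G) (GT : G setT).

Lemma eq_law_from_generators (X Y : Omega -> T) :
  measurable_fun setT X -> measurable_fun setT Y ->
  (forall A, G A -> P (X @^-1` A) = P (Y @^-1` A)) ->
  forall A, measurable A -> P (X @^-1` A) = P (Y @^-1` A).
Proof.
move=> mX mY XY A mA.
pose X' : {RV P >-> T} := HB.pack X (isMeasurableFun.Build _ _ _ _ X mX).
pose Y' : {RV P >-> T} := HB.pack Y (isMeasurableFun.Build _ _ _ _ Y mY).
apply: (measure_unique G (fun=> setT) mG GI _ _ (distribution P X') (distribution P Y')) => //.
- exact: bigcup_const.
- by move=> _; rewrite /= /distribution /pushforward preimage_setT probability_setT ltry.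
Qed.

(** With [E] fixed, both sides are finite measures in [A]: the image under [X] of [P] restricted to
    [E], and the law of [X] scaled by [P E]. Finite measures agreeing on the pi-system are equal. *)
Lemma indep_from_generators (X : Omega -> T) (E : set Omega) :
  measurable_fun setT X -> measurable E ->
  (forall A, G A -> P (X @^-1` A `&` E) = P (X @^-1` A) * P E) ->
  forall A, measurable A -> P (X @^-1` A `&` E) = P (X @^-1` A) * P E.
Proof.
move=> mX mE XE A mA.
pose X' : {RV P >-> T} := HB.pack X (isMeasurableFun.Build _ _ _ _ X mX).
have PE0 : (0 <= fine (P E))%R by exact: fine_ge0.
pose m1 : {measure set T -> \bar R} := pushforward (mrestr P mE) X'.
pose m2 : {measure set T -> \bar R} := mscale (NngNum PE0) (distribution P X').
have m2E B : m2 B = P (X @^-1` B) * P E.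
  by rewrite /m2/= /mscale/= fineK ?fin_num_measure// muleC.
rewrite -m2E -[LHS]/(m1 mX A).
apply: (measure_unique G (fun=> setT) mG GI _ _ (m1 mX) m2) => //.
- exact: bigcup_const.
- by move=> B GB; rewrite m2E -XE.
- move=> _; rewrite /m1/= /pushforward/= /mrestr preimage_setT setTI.
  by rewrite (le_lt_trans (probability_le1 _ _))// ltry.
Qed.

End independence_from_generators.

HB.instance Definition _ (k : nat) := Finite.on (signs k).
HB.instance Definition _ (k : nat) := isPointed.Build (signs k) [ffun=> true].

(** * The space of observations: a type together with a sign pattern *)

Section observations.
Context (R : realType) (k dt : nat).

Definition obs_box (A : 'I_dt -> set R) (B : set (signs k)) :
    set ('rV[R]_dt * signs k) :=
  [set z : 'rV[R]_dt * signs k | (forall j, A j (z.1 0 j)) /\ B z.2].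

Definition obs_boxes : set (set ('rV[R]_dt * signs k)) :=
  [set C | exists A B, (forall j, measurable (A j)) /\ C = obs_box A B].

(* The sigma-algebra is generated by boxes because [indep_family] and the
   equality of laws are only assumed on boxes. *)
Definition obs : Type := g_sigma_algebraType obs_boxes.
HB.instance Definition _ := Measurable.on obs.

Lemma obs_boxesT : obs_boxes setT.
Proof.
exists (fun=> setT), setT; split => //.
by apply/seteqP; split.
Qed.

Lemma obs_boxesI : setI_closed obs_boxes.
Proof.
move=> _ _ [A [B [mA ->]]] [A' [B' [mA' ->]]].
exists (fun j => A j `&` A' j), (B `&` B'); split.
  by move=> j; exact: measurableI.
apply/seteqP; split => z /=.
  by move=> [[zA zB] [zA' zB']]; split => // j; split.
by move=> [zA [zB zB']]; split; split => // j; case: (zA j).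
Qed.

Lemma measurable_obsE : @measurable _ obs = <<s obs_boxes >>.
Proof. by []. Qed.

Section maps_to_observations.
Context (d : measure_display) (T : measurableType d)
  (th : T -> 'rV[R]_dt) (ep : T -> signs k).
Hypotheses (mth : forall j, measurable_fun setT (fun t => th t 0 j))
  (mep : forall s, measurable (ep @^-1` [set s])).

Lemma measurable_signs (B : set (signs k)) : measurable (ep @^-1` B).
Proof.
have -> : ep @^-1` B = \bigcup_(s in B) ep @^-1` [set s].
  by apply/seteqP; split => [t Bt|t [s Bs /= ->]//]; exists (ep t).
by apply: fin_bigcup_measurable => //; exact: finite_finset.
Qed.

Lemma measurable_in_box (A : 'I_dt -> set R) :
  (forall j, measurable (A j)) -> measurable (in_box th A).
Proof.
move=> mA.
have -> : in_box th A =
    \bigcap_(j in [set: 'I_dt]) ((fun t => th t 0 j) @^-1` A j).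
  by apply/seteqP; split => t /= tA j; [move=> _|]; exact: tA.
apply: fin_bigcap_measurable => // j _.
by rewrite -[_ @^-1` _]setTI; exact: mth.
Qed.

Lemma measurable_obs_map : measurable_fun setT (fun t => (th t, ep t) : obs).
Proof.
apply: (measurability _ measurable_obsE) => _ [_ [A [B [mA ->]]] <-].
rewrite setTI [X in measurable X](_ : _ = in_box th A `&` ep @^-1` B)//.
by apply: measurableI; [exact: measurable_in_box|exact: measurable_signs].
Qed.

(** There are finitely many sign patterns, so the map is a finite sum of continuous functions of
    [th], each times the indicator of one pattern. *)
Lemma measurable_obs_comp (f : 'rV[R]_dt * signs k -> R) :
  (forall s, continuous (fun v => f (v, s))) ->
  measurable_fun setT (fun t => f (th t, ep t)).
Proof.
move=> cf.
have -> : (fun t => f (th t, ep t)) =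
    fun t => \sum_(s : signs k) f (th t, s) * \1_(ep @^-1` [set s]) t.
  apply/funext => t; rewrite (bigD1 (ep t))//= indicE mem_set// mulr1.
  rewrite big1 ?addr0// => s sne; rewrite indicE memNset ?mulr0//.
  by move=> /= es; rewrite es eqxx in sne.
apply: measurable_sum => s; apply: measurable_funM.
  exact: (measurable_continuous_rV (cf s)).
exact: measurable_indic.
Qed.

End maps_to_observations.

(** The two projections of [obs] satisfy the hypotheses of [measurable_obs_comp], since a condition
    on one coordinate, or on the pattern alone, is a generating box. *)
Lemma measurable_obs_fun (f : obs -> R) :
  (forall s, continuous (fun v => f (v, s))) -> measurable_fun setT f.
Proof.
move=> cf.
have := @measurable_obs_comp _ obs fst snd _ _ f cf.
have -> : (fun t : obs => f (t.1, t.2)) = f by apply/funext => -[].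
apply.
- move=> j _ A mA; rewrite setTI; apply: sub_sigma_algebra.
  exists (fun i => if i == j then A else setT), setT; split.
    by move=> i; case: ifP.
  apply/seteqP; split => [z /= zA|z /= [/(_ j)]]; last by rewrite eqxx.
  by split => // i; case: eqP => // ->.
- move=> s; apply: sub_sigma_algebra.
  exists (fun=> setT), [set s]; split => //.
  by apply/seteqP; split => [z|z []].
Qed.

End observations.

(** * Common law, independence and averages of the sampled observations *)

Section sampling.
Context (R : realType) (k dt : nat) (d : measure_display) (Omega : measurableType d)
  (P : probability Omega R)
  (theta : nat -> Omega -> 'rV[R]_dt) (eps : nat -> Omega -> signs k).
Hypotheses (theta_meas : forall i j, measurable_fun setT (fun om => theta i om 0 j))
  (eps_meas : forall i (s : signs k), measurable (eps i @^-1` [set s]))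
  (theta_id : forall i (A : 'I_dt -> set R), (forall j, measurable (A j)) ->
     P (in_box (theta i) A) = P (in_box (theta 0%N) A))
  (eps_unif : forall i (s : signs k),
     P (eps i @^-1` [set s]) = ((2 ^ k)%:R^-1)%:E)
  (Hindep : indep_family P theta eps).
Local Open Scope ereal_scope.

Definition sample (i : nat) (om : Omega) : obs R k dt := (theta i om, eps i om).

Lemma measurable_sample i : measurable_fun setT (sample i).
Proof. exact: measurable_obs_map. Qed.

Lemma sample_boxE i A B :
  sample i @^-1` obs_box A B = in_box (theta i) A `&` eps i @^-1` B.
Proof. by []. Qed.

(** This is the product rule on the first [j + 1] indices, with full sets at every index other than
    [i] and [j]. *)
Lemma prob_box_pair i j A B A' B' : (i < j)%N ->
  (forall l, measurable (A l)) -> (forall l, measurable (A' l)) ->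
  P (sample i @^-1` obs_box A B `&` sample j @^-1` obs_box A' B') =
  (P (in_box (theta i) A) * P (eps i @^-1` B)) *
  (P (in_box (theta j) A') * P (eps j @^-1` B')).
Proof.
move=> ij mA mA'.
pose A2 l : 'I_dt -> set R :=
  if l == i then A else if l == j then A' else fun=> setT.
pose B2 l : set (signs k) := if l == i then B else if l == j then B' else setT.
have mA2 l m : measurable (A2 l m).
  by rewrite /A2; case: ifP => // _; case: ifP.
have ji : (j == i) = false by rewrite gtn_eqF.
have A2i : A2 i = A by rewrite /A2 eqxx.
have A2j : A2 j = A' by rewrite /A2 ji eqxx.
have B2i : B2 i = B by rewrite /B2 eqxx.
have B2j : B2 j = B' by rewrite /B2 ji eqxx.
have := Hindep j.+1 B2 mA2.
set I := \bigcap_(_ in _) _.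
have -> : I = sample i @^-1` obs_box A B `&` sample j @^-1` obs_box A' B'.
  rewrite /I !sample_boxE; apply/seteqP; split => [om H|om [Hi Hj] l lj].
    split; first by have := H i (ltnW ij); rewrite A2i B2i.
    by have := H j (ltnSn j); rewrite A2j B2j.
  rewrite /A2 /B2; case: eqP => [->//|_]; case: eqP => [->//|_].
  by split.
move=> ->.
rewrite (bigD1 (Ordinal (ltnW ij : (i < j.+1)%N)))//= A2i B2i.
rewrite (bigD1 (Ordinal (ltnSn j)))/=; last by rewrite -val_eqE/= ji.
rewrite A2j B2j big1 ?mule1// => l /andP[li lj].
rewrite -!val_eqE/= in li lj.
rewrite /A2 /B2 (negbTE li) (negbTE lj).
have -> : in_box (theta l) (fun=> setT) = setT by apply/seteqP; split.
by rewrite preimage_setT probability_setT mule1.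
Qed.

Lemma prob_box i A B : (forall l, measurable (A l)) ->
  P (sample i @^-1` obs_box A B) = P (in_box (theta i) A) * P (eps i @^-1` B).
Proof.
move=> mA; have := @prob_box_pair i i.+1 A B (fun=> setT) setT (ltnSn i) mA.
have -> : in_box (theta i.+1) (fun=> setT) = setT by apply/seteqP; split.
have -> : sample i.+1 @^-1` obs_box (fun=> setT) setT = setT.
  by apply/seteqP; split.
by rewrite preimage_setT probability_setT setIT !mule1; exact.
Qed.

Lemma eps_law i (B : set (signs k)) : P (eps i @^-1` B) = P (eps 0%N @^-1` B).
Proof.
have cup l : eps l @^-1` B = \bigcup_(s in B) eps l @^-1` [set s].
  by apply/seteqP; split => [t Bt|t [s Bs /= ->]//]; exists (eps l t).
have triv l : trivIset B (fun s => eps l @^-1` [set s]).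
  by move=> s t _ _ [om [/= <- <-]].
have finB : finite_set B by exact: finite_finset.
rewrite cup [in RHS]cup !measure_fin_bigcup//.
by apply: eq_fsbigr => s _; rewrite [LHS]eps_unif [RHS]eps_unif.
Qed.

Lemma sample_id i (A : set (obs R k dt)) : measurable A ->
  P (sample i @^-1` A) = P (sample 0%N @^-1` A).
Proof.
apply: (eq_law_from_generators (@measurable_obsE R k dt) (@obs_boxesI R k dt)
  (@obs_boxesT R k dt)).
- exact: measurable_sample.
- exact: measurable_sample.
move=> _ [A' [B [mA' ->]]].
by rewrite !prob_box// theta_id// eps_law.
Qed.

(** The extension from boxes is made twice: in [A] with an arbitrary [B] held fixed, then in [B]
    with [A] a box. *)
Lemma sample_indep i j (A B : set (obs R k dt)) : (i < j)%N ->
  measurable A -> measurable B ->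
  P (sample i @^-1` A `&` sample j @^-1` B) =
  P (sample i @^-1` A) * P (sample j @^-1` B).
Proof.
move=> ij mA mB.
have msample l (C : set (obs R k dt)) : measurable C -> measurable (sample l @^-1` C).
  by move=> mC; rewrite -[_ @^-1` _]setTI; exact: measurable_sample.
apply: (indep_from_generators (@measurable_obsE R k dt) (@obs_boxesI R k dt)
  (@obs_boxesT R k dt)) mA => //.
- exact: measurable_sample.
- exact: msample.
move=> A' GA'; rewrite setIC [RHS]muleC.
apply: (indep_from_generators (@measurable_obsE R k dt) (@obs_boxesI R k dt)
  (@obs_boxesT R k dt)) mB => //.
- exact: measurable_sample.
- by apply: msample; exact: sub_sigma_algebra.
move=> _ [A2 [B2 [mA2 ->]]]; case: GA' => [A1 [B1 [mA1 ->]]].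
by rewrite setIC [RHS]muleC prob_box_pair// !prob_box.
Qed.

(** Freezing the pattern at [s] turns a box into an event about [theta 0] alone, or into the empty
    set if the box excludes [s]. *)
Lemma eps_theta_indep (s : signs k) (B : set (signs k)) (A : set (obs R k dt)) :
  measurable A ->
  P ((fun om => (theta 0%N om, s) : obs R k dt) @^-1` A `&` eps 0%N @^-1` B) =
  P ((fun om => (theta 0%N om, s) : obs R k dt) @^-1` A) * P (eps 0%N @^-1` B).
Proof.
have mcst (t : signs k) : measurable ((fun=> s : signs k) @^-1` [set t] : set Omega).
  by rewrite preimage_cst; case: ifP.
apply: (indep_from_generators (@measurable_obsE R k dt) (@obs_boxesI R k dt)
  (@obs_boxesT R k dt)) => //.
- exact: measurable_obs_map.
- exact: measurable_signs.
move=> _ [A1 [B1 [mA1 ->]]].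
have [Bs|nBs] := pselect (B1 s).
  have -> : (fun om => (theta 0%N om, s)) @^-1` obs_box A1 B1 = in_box (theta 0%N) A1.
    by apply/seteqP; split => om /=; [case|split].
  by rewrite -prob_box.
have -> : (fun om => (theta 0%N om, s)) @^-1` obs_box A1 B1 = set0.
  by apply/seteqP; split => om //= -[].
by rewrite set0I measure0 mul0e.
Qed.

Section observed_function.
Variables (f : obs R k dt -> R) (M : R).
Hypotheses (cf : forall s, continuous (fun v => f (v, s)))
  (fM : forall s, \int[P]_om (f (theta 0%N om, s) ^+ 2)%:E <= M%:E).

Let mfs (s : signs k) : measurable_fun setT (fun om => f (theta 0%N om, s)).
Proof.
have := @measurable_continuous_rV R dt _ Omega (fun v => f (v, s)) (theta 0%N) (@cf s).
by apply; exact: theta_meas.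
Qed.

Let fs2 (s : signs k) : (fun om => f (theta 0%N om, s)) \in Lfun P 2%:E.
Proof.
by apply: sqr_integrable_Lfun2 => //; exact: le_lt_trans (fM s) (ltry _).
Qed.

Let sampleE om : f (sample 0%N om) =
  (\sum_(s : signs k) \1_(eps 0%N @^-1` [set s]) om * f (theta 0%N om, s))%R.
Proof.
rewrite (bigD1 (eps 0%N om))//= indicE mem_set// mul1r.
rewrite big1 ?addr0// => s sne; rewrite indicE memNset ?mul0r//.
by move=> /= es; rewrite es eqxx in sne.
Qed.

(** The square at the drawn pattern is at most the sum of the squares over all [2 ^ k] patterns;
    this crude bound suffices for the rate. *)
Lemma second_moment_sample :
  \int[P]_om (f (sample 0%N om) ^+ 2)%:E <= ((2 ^ k)%:R * M)%:E.
Proof.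
apply: (@le_trans _ _ (\int[P]_om (\sum_(s : signs k) (f (theta 0%N om, s) ^+ 2)%:E))).
  apply: ge0_le_integral => //.
  - by move=> om _; rewrite lee_fin sqr_ge0.
  - apply/measurable_EFinP; apply: measurable_funX.
    exact: measurable_obs_comp.
  - apply: emeasurable_sum => s.
    by apply/measurable_EFinP; exact: measurable_funX.
  - move=> om _; rewrite sumEFin lee_fin /sample (bigD1 (eps 0%N om))//= lerDl.
    by apply: sumr_ge0 => s _; exact: sqr_ge0.
rewrite ge0_integral_sum//; first last.
- by move=> s om _; rewrite lee_fin sqr_ge0.
- by move=> s; apply/measurable_EFinP; exact: measurable_funX.
apply: (@le_trans _ _ (\sum_(s : signs k) M%:E)).
  by apply: lee_sum => s _; exact: fM.
by rewrite sumEFin sumr_const card_ffun card_bool card_ord mulr_natl.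
Qed.

(** Split according to the drawn pattern: each indicator has mean [2 ^- k] and is independent of
    [theta 0]. *)
Lemma mean_sample : fine (\int[P]_om (f (sample 0%N om))%:E) =
  ((2 ^ k)%:R^-1 * \sum_(s : signs k) fine (\int[P]_om (f (theta 0%N om, s))%:E))%R.
Proof.
have Pfin : P setT \is a fin_num := fin_num_measure P _ measurableT.
have ind2 (s : signs k) : (\1_(eps 0%N @^-1` [set s]) : Omega -> R) \in Lfun P 2%:E.
  apply: sqr_integrable_Lfun2; first exact: measurable_indic.
  apply: (@le_lt_trans _ _ (\int[P]_om (cst 1%:E om))).
    apply: ge0_le_integral => //.
    - by apply/measurable_EFinP; apply: measurable_funX; exact: measurable_indic.
    - by move=> om _; rewrite /= lee_fin indicE; case: (_ \in _); rewrite ?expr1n ?expr0n.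
  by rewrite integral_cst//= probability_setT mule1 ltry.
have termE (s : signs k) :
    \int[P]_om (\1_(eps 0%N @^-1` [set s]) om * f (theta 0%N om, s))%:E =
    ((2 ^ k)%:R^-1 * fine (\int[P]_om (f (theta 0%N om, s))%:E))%:E.
  have := @expectationM_indep _ _ _ P _ _ (ind2 s) (fs2 s).
  rewrite expectation_indic// eps_unif.
  rewrite -(fineK (expectation_fin_num (Lfun_subset12 Pfin (fs2 s)))).
  rewrite -EFinM unlock => -> // A B mA mB.
  (* An event about the indicator is an event about the sign pattern, to which [eps_theta_indep]
     applies. *)
  rewrite (_ : \1_(eps 0%N @^-1` [set s]) @^-1` A =
    eps 0%N @^-1` [set t | A (\1_[set s] t)]); last first.
    by apply/seteqP; split => om /=; rewrite !indicE.
  rewrite setIC [RHS]muleC.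
  apply: (@eps_theta_indep s _ (f @^-1` B)).
  by rewrite -[_ @^-1` _]setTI; apply: measurable_obs_fun.
under eq_integral do rewrite sampleE -sumEFin.
rewrite integral_sum//; last first.
  by move=> s; have /Lfun1_integrable := Lfun2_mul_Lfun1 (ind2 s) (fs2 s).
under eq_bigr do rewrite termE.
by rewrite sumEFin/= mulr_sumr.
Qed.

Lemma sample_average_deviation (delta : R) (n : nat) :
  (0 < n)%N -> (0 < delta)%R ->
  P [set om | (delta <= `|n%:R^-1 * (\sum_(i < n) f (sample i om)) -
      (2 ^ k)%:R^-1 * \sum_(s : signs k) fine (\int[P]_om (f (theta 0%N om, s))%:E)|)%R]
    <= ((2 ^ k)%:R * M / (n%:R * delta ^+ 2))%:E.
Proof.
move=> n0 delta0; rewrite -mean_sample; apply: weak_lln => //.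
- exact: measurable_sample.
- exact: sample_id.
- exact: sample_indep.
- exact: measurable_obs_fun.
- exact: second_moment_sample.
Qed.

Lemma measurable_sample_average (n : nat) :
  measurable_fun setT (fun om => \sum_(i < n) f (sample i om))%R.
Proof.
by apply: measurable_sum => i; exact: measurable_obs_comp.
Qed.

End observed_function.
End sampling.

(** * Sums over sign patterns and averaged difference quotients *)

Section sign_sums.
Context (R : realType) (k : nat).

Definition flip (j : 'I_k) (s : signs k) : signs k :=
  [ffun i => if i == j then ~~ s i else s i].

Lemma flipK j : involutive (flip j).
Proof.
by move=> s; apply/ffunP => i; rewrite !ffunE; case: eqP => //; rewrite negbK.
Qed.

Lemma sgnvec_flip j l s :
  sgnvec R (flip j s) 0 l = if l == j then - sgnvec R s 0 l else sgnvec R s 0 l.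
Proof.
rewrite !mxE ffunE; case: (l == j) => //.
by case: (s l) => /=; rewrite ?opprK.
Qed.

Lemma sgnvec_sqr (s : signs k) j : sgnvec R s 0 j * sgnvec R s 0 j = 1.
Proof. by rewrite mxE; case: ifP; rewrite ?mulrNN mulr1. Qed.

Lemma sgnvec_norm (s : signs k) j : `|sgnvec R s 0 j| = 1.
Proof. by rewrite mxE; case: ifP; rewrite ?normrN normr1. Qed.

(** Flipping coordinate [j] permutes the patterns, so the sum equals its own opposite. *)
Lemma sum_flip_odd (F : signs k -> R) j :
  (forall s, F (flip j s) = - F s) -> \sum_s F s = 0.
Proof.
move=> Fodd; have : \sum_s F s = - \sum_s F s; last by lra.
rewrite {1}(reindex_inj (inv_inj (flipK j)))/=.
by under eq_bigr do rewrite Fodd; rewrite sumrN.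
Qed.

Lemma sum_sgnvec (j : 'I_k) : \sum_s sgnvec R s 0 j = 0 :> R.
Proof. by apply: (@sum_flip_odd _ j) => s; rewrite sgnvec_flip eqxx. Qed.

Lemma sum_sgnvecM (j l : 'I_k) :
  \sum_s sgnvec R s 0 j * sgnvec R s 0 l = (2 ^ k)%:R * (j == l)%:R :> R.
Proof.
have [<-|jl] := eqVneq j l.
  under eq_bigr do rewrite sgnvec_sqr.
  by rewrite sumr_const card_ffun card_bool card_ord mulr1.
rewrite mulr0; apply: (@sum_flip_odd _ j) => s.
by rewrite !sgnvec_flip eqxx eq_sym (negbTE jl) mulNr.
Qed.

(** The norm is the sup norm; it is 0 rather than 1 when [k = 0], hence an inequality. *)
Lemma sgnvec_normmx (s : signs k) : `|sgnvec R s| <= 1.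
Proof.
rewrite [leLHS]/Num.norm/= mx_normrE; apply: bigmax_le => // -[i j] _ /=.
by rewrite ord1 sgnvec_norm.
Qed.

(* The averaged difference quotients in the random sign directions recover the
   partial derivatives because the sign vectors have identity covariance. *)
Lemma sign_average_cvg (F : 'rV[R]_k -> R) (b : 'rV[R]_k) (h : nat -> R)
    (j : 'I_k) :
  differentiable F b -> h @ \oo --> 0 -> (\forall n \near \oo, h n != 0) ->
  (fun n => (2 ^ k)%:R^-1 *
     \sum_s (sgnvec R s 0 j / h n) * F (b + h n *: sgnvec R s)) @ \oo
    --> 'D_(delta_mx 0 j) F b.
Proof.
move=> dF h0 hn0.
have quo (s : signs k) :
    (fun n => (h n)^-1 * (F (b + h n *: sgnvec R s) - F b)) @ \oo
      --> \sum_l sgnvec R s 0 l * 'D_(delta_mx 0 l) F b.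
  have -> : \sum_l sgnvec R s 0 l * 'D_(delta_mx 0 l) F b = 'D_(sgnvec R s) F b.
    rewrite deriveE// [in RHS](row_sum_delta (sgnvec R s)) linear_sum.
    by apply: eq_bigr => l _; rewrite deriveE// linearZ.
  have dsF : derivable F b (sgnvec R s) by exact: diff_derivable.
  (* The directional derivative is a limit over punctured neighbourhoods of 0, so [h] must
     eventually avoid 0. *)
  have hd : h @ \oo --> (0 : R)^'.
    move=> A /= /h0 hA; near=> n; near: n.
    by apply: filterS2 hA hn0 => n /=; exact.
  rewrite [X in X @ \oo](_ : _ =
    (fun u : R => u^-1 *: ((F \o shift b) (u *: sgnvec R s) - F b)) \o h); last first.
    by apply/funext => n; rewrite /= [b + _]addrC.
  exact: cvg_comp hd dsF.
have lim : 'D_(delta_mx 0 j) F b = (2 ^ k)%:R^-1 *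
    \sum_s sgnvec R s 0 j * (\sum_l sgnvec R s 0 l * 'D_(delta_mx 0 l) F b).
  under eq_bigr do rewrite mulr_sumr.
  rewrite exchange_big/= (bigD1 j)//= [X in _ + X]big1 ?addr0; last first.
    move=> l lj; under eq_bigr do rewrite mulrA.
    by rewrite -mulr_suml sum_sgnvecM eq_sym (negbTE lj) mulr0 mul0r.
  under eq_bigr do rewrite mulrA.
  rewrite -mulr_suml sum_sgnvecM eqxx mulr1 mulrA mulVf ?mul1r//.
rewrite lim.
(* Subtracting [F b] changes nothing, because the signs in coordinate [j] sum to zero. *)
have -> : (fun n => (2 ^ k)%:R^-1 *
     \sum_s (sgnvec R s 0 j / h n) * F (b + h n *: sgnvec R s)) =
  (fun n => (2 ^ k)%:R^-1 *
     \sum_s sgnvec R s 0 j * ((h n)^-1 * (F (b + h n *: sgnvec R s) - F b))).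
  apply/funext => n; congr (_ * _).
  under [RHS]eq_bigr do rewrite mulrA mulrBr.
  rewrite sumrB [X in _ - X](_ : _ = 0) ?subr0//.
  by rewrite -mulr_suml -mulr_suml sum_sgnvec !mul0r.
apply: cvgMr; apply: cvg_big => [|s _]; first exact: add_continuous.
by apply: cvgMr; exact: quo.
Unshelve. all: by end_near. Qed.

End sign_sums.

(** * Stability of linear systems close to the identity *)

Section perturbed_identity.
Context (R : realType) (k : nat).

(** At an index [m] where [|u m|] is largest, row [m] gives [|u m| <= B + k delta |u m| <= B + |u m|
    / 2]. *)
Lemma near_identity_solution_bound (S : 'M[R]_k) (u r : 'cV[R]_k) (delta B : R) :
  k%:R * delta <= 2^-1 -> (forall i j, `|S i j - (i == j)%:R| <= delta) ->
  S *m u = r -> (forall j, `|r j 0| <= B) -> forall j, `|u j 0| <= 2 * B.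
Proof.
move=> kd SI Su rB j.
have [m _ mP] := @arg_maxP _ _ _ j xpredT (fun i => `|u i 0|) erefl.
apply: (le_trans (mP j erefl)).
have um : u m 0 = r m 0 - \sum_l (S m l - (m == l)%:R) * u l 0.
  under eq_bigr do rewrite mulrBl.
  rewrite sumrB -Su mxE opprB addrCA subrr addr0.
  rewrite (bigD1 m)//= eqxx mul1r big1 ?addr0// => l lm.
  by rewrite eq_sym (negbTE lm) mul0r.
have sle : `|\sum_l (S m l - (m == l)%:R) * u l 0| <= k%:R * delta * `|u m 0|.
  apply: (le_trans (ler_norm_sum _ _ _)).
  have -> : k%:R * delta * `|u m 0| = \sum_(l < k) delta * `|u m 0|.
    by rewrite sumr_const card_ord -[RHS]mulr_natl mulrA.
  apply: ler_sum => l _; rewrite normrM; apply: ler_pM => //.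
  exact: mP.
have := ler_wpM2r (normr_ge0 (u m 0)) kd.
have : `|u m 0| <= `|r m 0| + `|\sum_l (S m l - (m == l)%:R) * u l 0|.
  by rewrite {1}um; exact: ler_normB.
have := rB m; lra.
Qed.

(** The previous bound with a zero right-hand side leaves only the zero kernel vector. The transpose
    appears because [det0P] yields a row vector. *)
Lemma near_identity_unitmx (S : 'M[R]_k) (delta : R) :
  k%:R * delta <= 2^-1 -> (forall i j, `|S i j - (i == j)%:R| <= delta) ->
  S \in unitmx.
Proof.
move=> kd SI; rewrite unitmxE unitfE; apply/negP => /det0P[v v0 vS].
have := v0; rewrite -trmx_eq0 => /negP; apply; apply/eqP/matrixP => i l.
rewrite (ord1 l) [RHS]mxE; apply/eqP; rewrite -normr_le0 -(mulr0 2).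
apply: (@near_identity_solution_bound S^T _ 0 delta) => //.
- by move=> a b; rewrite mxE eq_sym.
- by rewrite -trmx_mul vS trmx0.
- by move=> a; rewrite mxE normr0.
Qed.

(** The error [u - t] solves the same system with right-hand side [(g - t) - (S - 1) t], whose
    entries are at most [delta * (1 + \sum_l |t l|)]. *)
Lemma near_identity_solution_close (S : 'M[R]_k) (u g t : 'cV[R]_k) (delta : R) :
  k%:R * delta <= 2^-1 -> (forall i j, `|S i j - (i == j)%:R| <= delta) ->
  (forall j, `|g j 0 - t j 0| <= delta) -> S *m u = g ->
  forall j, `|u j 0 - t j 0| <= 2 * (delta * (1 + \sum_l `|t l 0|)).
Proof.
move=> kd SI gt Su j.
have -> : u j 0 - t j 0 = (u - t) j 0 by rewrite !mxE.
apply: (near_identity_solution_bound kd SI (erefl _)) => {}j.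
rewrite mulmxBr Su.
have -> : (g - S *m t) j 0 = (g j 0 - t j 0) - \sum_l (S j l - (j == l)%:R) * t l 0.
  under eq_bigr do rewrite mulrBl.
  rewrite sumrB !mxE (bigD1 j (F := fun l => (j == l)%:R * _))//= eqxx mul1r.
  rewrite [X in _ - (_ - (_ + X))]big1 ?addr0; last first.
    by move=> l lj; rewrite eq_sym (negbTE lj) mul0r.
  by rewrite opprB addrA subrK.
apply: (le_trans (ler_normB _ _)); rewrite mulrDr mulr1 lerD//.
apply: (le_trans (ler_norm_sum _ _ _)); rewrite mulr_sumr.
by apply: ler_sum => l _; rewrite normrM ler_wpM2r.
Qed.

(** Dividing by [k + 1] covers [k = 0] and suffices since [k <= (k + 1) ^ 2]. *)
Lemma euclid_le (v : 'cV[R]_k) (e : R) : 0 <= e ->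
  (forall j, `|v j 0| <= e / k.+1%:R) -> euclid v <= e.
Proof.
move=> e0 ve; rewrite /euclid -(ger0_norm e0) -sqrtr_sqr ler_wsqrtr//.
apply: (@le_trans _ _ (\sum_(i < k) (e / k.+1%:R) ^+ 2)).
  apply: ler_sum => i _; rewrite big_ord1 -real_normK ?num_real//.
  by rewrite lerXn2r// nnegrE ?divr_ge0.
rewrite sumr_const card_ord -[leLHS]mulr_natl expr_div_n mulrCA ler_piMr ?sqr_ge0//.
rewrite ler_pdivrMr ?mul1r ?exprn_gt0// -natrX ler_nat.
by rewrite -[leqLHS]muln1 leq_mul.
Qed.

End perturbed_identity.

(** * Limits of the step size and of [n h^2] *)

Section rates.
Context (R : realType).

Lemma natr_powR_cvgy (b : R) : 0 < b -> (fun n : nat => n%:R `^ b) @ \oo --> +oo.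
Proof.
move=> b0; apply/cvgryPge => A; near=> n.
have [A0|A0] := leP A 0; first exact: le_trans (powR_ge0 _ _).
have : A `^ b^-1 <= n%:R by near: n; exact: nbhs_infty_ger.
move=> /(ge0_ler_powR (ltW b0)).
rewrite -powRrM mulVf ?gt_eqF// powRr1 ?(ltW A0)//; apply; rewrite nnegrE//.
exact: powR_ge0.
Unshelve. all: by end_near. Qed.

Lemma step_size_cvg0 (c alpha : R) : 0 < alpha ->
  (fun n : nat => c * n%:R `^ (- alpha)) @ \oo --> 0.
Proof.
move=> a0; rewrite -(mulr0 c); apply: cvgMr.
under eq_fun do rewrite powRN.
apply/(@gtr0_cvgV0 R _ _ _ (fun n : nat => n%:R `^ alpha)).
  by near=> n; rewrite powR_gt0// ltr0n; near: n; exact: nbhs_infty_gt.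
exact: natr_powR_cvgy.
Unshelve. all: by end_near. Qed.

(** For positive [n], [n h^2 = c^2 n^(1 - 2 alpha)], and the exponent is positive exactly when
    [alpha < 1 / 2]. *)
Lemma effective_sample_size_cvg (c alpha : R) : 0 < c -> alpha < 1 / 2 ->
  (fun n : nat => (n%:R * (c * n%:R `^ (- alpha)) ^+ 2)^-1) @ \oo --> 0.
Proof.
move=> c0 a2.
apply/(@gtr0_cvgV0 R _ _ _ (fun n : nat => n%:R * (c * n%:R `^ (- alpha)) ^+ 2)).
  near=> n; have n0 : 0 < n%:R :> R by rewrite ltr0n; near: n; exact: nbhs_infty_gt.
  by rewrite mulr_gt0// exprn_gt0// mulr_gt0// powR_gt0.
have : (fun n : nat => c ^+ 2 * n%:R `^ (1 - 2 * alpha)) @ \oo --> +oo.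
  have c20 : 0 < c ^+ 2 by rewrite exprn_gt0.
  have b0 : 0 < 1 - 2 * alpha by lra.
  apply/cvgryPge => A; near=> n; rewrite -ler_pdivrMl//.
  by near: n; move: (_ * A); apply/cvgryPge; exact: (natr_powR_cvgy b0).
apply: cvg_trans; apply: near_eq_cvg; near=> n.
have n0 : 0 < n%:R :> R by rewrite ltr0n; near: n; exact: nbhs_infty_gt.
have nE : 1 - 2 * alpha = 1 + - alpha * 2 by ring.
rewrite exprMn -[(_ `^ _) ^+ 2]powR_mulrn ?powR_ge0// -powRrM mulrCA nE.
rewrite powRD; last by apply/implyP => _; rewrite gt_eqF.
by rewrite powRr1 ?(ltW n0).
Unshelve. all: by end_near. Qed.

End rates.

(** * Measurability of estimation events, and the union bound *)

Section measurable_events.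
Context (R : realType) (k : nat) (d : measure_display) (Omega : measurableType d).

Lemma measurable_euclid_gt (v : Omega -> 'cV[R]_k) (e : R) :
  (forall j, measurable_fun setT (fun om => v om j 0)) ->
  measurable [set om | e < euclid (v om)].
Proof.
move=> mv.
have mE : measurable_fun setT (fun om => euclid (v om)).
  rewrite /euclid.
  apply: (measurableT_comp (continuous_measurable_fun (@sqrt_continuous R))).
  apply: measurable_sum => i; apply: measurable_sum => j; rewrite ord1.
  exact: measurable_funX.
have := mE measurableT _ (measurable_itv `]e, +oo[).
by rewrite setTI; congr measurable; apply/seteqP; split => om /=;
  rewrite in_itv/= andbT.
Qed.

(** This avoids measurability of matrix inversion: [n] draws give finitely many joint patterns, and
    the design matrix is constant on each. *)
Lemma measurable_sign_pattern (eps : nat -> Omega -> signs k) (n : nat)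
    (E : {ffun 'I_n -> signs k} -> set Omega) :
  (forall i s, measurable (eps i @^-1` [set s])) ->
  (forall p, measurable (E p)) ->
  measurable [set om | E [ffun i : 'I_n => eps i om] om].
Proof.
move=> meps mE.
have -> : [set om | E [ffun i : 'I_n => eps i om] om] =
    \bigcup_(p in [set: {ffun 'I_n -> signs k}])
      ((\bigcap_(i in [set: 'I_n]) eps i @^-1` [set p i]) `&` E p).
  apply/seteqP; split => [om Eom|om [p _ [pom Ep]]] /=.
    by exists [ffun i : 'I_n => eps i om] => //; split => // i _ /=; rewrite ffunE.
  suff -> : [ffun i : 'I_n => eps i om] = p by [].
  by apply/ffunP => i; rewrite ffunE; exact: pom.
apply: fin_bigcup_measurable; first exact: finite_finset.
by move=> p _; apply: measurableI => //; exact: fin_bigcap_measurable.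
Qed.

Lemma measure_bigsetU_le (P : {measure set Omega -> \bar R}) (I : Type) (r : seq I)
    (F : I -> set Omega) : (forall i, measurable (F i)) ->
  (P (\big[setU/set0]_(i <- r) F i) <= \sum_(i <- r) P (F i))%E.
Proof.
move=> mF; elim: r => [|i r IH]; first by rewrite !big_nil measure0.
rewrite !big_cons (le_trans (measureU2 P _ _))//; first exact: bigsetU_measurable.
by rewrite leeD2l.
Qed.

End measurable_events.

(** * Continuity of the objective in the type, and the deterministic OLS error bound *)

Lemma continuous_pobj (R : realType) (k dx dt : nat)
    (w : 'rV[R]_dx -> 'rV[R]_k -> R) (x : 'rV[R]_k -> 'rV[R]_dt -> 'rV[R]_dx)
    (y : R -> 'rV[R]_dt -> R) (piF : R -> R -> R) (beta : 'rV[R]_k) :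
  C1 (fun p : 'rV[R]_dx * 'rV[R]_k => w p.1 p.2) ->
  C1 (fun p : 'rV[R]_k * 'rV[R]_dt => x p.1 p.2) ->
  C1 (fun p : R^o * 'rV[R]_dt => y p.1 p.2) ->
  C1 (fun p : R^o * R^o => piF p.1 p.2) ->
  continuous (pobj w x y piF beta).
Proof.
move=> [dw _] [dx' _] [dy _] [dpi _] v.
have cw p : {for p, continuous (fun p => w p.1 p.2)} by exact: differentiable_continuous.
have cx p : {for p, continuous (fun p => x p.1 p.2)} by exact: differentiable_continuous.
have cy p : {for p, continuous (fun p : R^o * 'rV[R]_dt => y p.1 p.2)}.
  exact: differentiable_continuous.
have cpi p : {for p, continuous (fun p : R^o * R^o => piF p.1 p.2)}.
  exact: differentiable_continuous.
pose W v := w (x beta v) beta.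
have cX : (fun v => x beta v) @ v --> x beta v.
  apply: (@continuous2_cvg _ 'rV[R]_k 'rV[R]_dt 'rV[R]_dx (nbhs v) _
    (fun=> beta) id x beta v); [exact: (cx (beta, v))|exact: cvg_cst|exact: cvg_id].
have cW : W @ v --> W v.
  apply: (@continuous2_cvg _ 'rV[R]_dx 'rV[R]_k R (nbhs v) _ (x beta) (fun=> beta) w);
    [exact: (cw (x beta v, beta))|exact: cX|exact: cvg_cst].
have cY : (fun v => y (W v) v) @ v --> y (W v) v.
  apply: (@continuous2_cvg _ R 'rV[R]_dt R (nbhs v) _ W id y);
    [exact: (cy (W v, v))|exact: cW|exact: cvg_id].
apply: (@continuous2_cvg _ R R R (nbhs v) _ W (fun v => y (W v) v) piF);
  [exact: (cpi (W v, y (W v) v))|exact: cW|exact: cY].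
Qed.

(** Dividing the normal equations by [n h^2] turns their coefficients into the averages in the
    hypotheses, that is, into a system close to the identity. *)
Lemma ols_close (R : realType) (k n : nat) (h delta e : R) (E : 'I_n -> signs k)
    (p : 'cV[R]_n) (t : 'cV[R]_k) :
  let Q : 'M[R]_(n, k) := \matrix_(i < n, j < k) (h * sgnvec R (E i) 0 j) in
  (0 < n)%N -> 0 < h -> 0 <= e -> k%:R * delta <= 2^-1 ->
  2 * (delta * (1 + \sum_l `|t l 0|)) <= e / k.+1%:R ->
  (forall j l, `|n%:R^-1 * (\sum_(i < n) sgnvec R (E i) 0 j * sgnvec R (E i) 0 l)
                 - (j == l)%:R| <= delta) ->
  (forall j, `|n%:R^-1 * (\sum_(i < n) sgnvec R (E i) 0 j / h * p i 0)
               - t j 0| <= delta) ->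
  euclid (invmx (Q^T *m Q) *m Q^T *m p - t) <= e.
Proof.
move=> Q n0 h0 e0 kd de SI gt; apply: euclid_le => // j.
have n0' : n%:R != 0 :> R by rewrite pnatr_eq0 -lt0n.
have h0' : h != 0 by rewrite gt_eqF.
pose a : R := n%:R * h ^+ 2.
have a0 : a != 0 by rewrite mulf_neq0// expf_neq0.
pose S := a^-1 *: (Q^T *m Q).
pose g := a^-1 *: (Q^T *m p).
have SE i l : S i l =
    n%:R^-1 * (\sum_(m < n) sgnvec R (E m) 0 i * sgnvec R (E m) 0 l).
  rewrite mxE mxE !mulr_sumr; apply: eq_bigr => m _.
  by rewrite /Q 3!mxE /a; field; rewrite n0' h0'.
have gE i : g i 0 = n%:R^-1 * (\sum_(m < n) sgnvec R (E m) 0 i / h * p m 0).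
  rewrite mxE mxE !mulr_sumr; apply: eq_bigr => m _.
  by rewrite /Q 2!mxE /a; field; rewrite n0' h0'.
have SI' i l : `|S i l - (i == l)%:R| <= delta by rewrite SE.
(* [invmx] leaves a singular matrix unchanged, so invertibility must be known before it can be
   cancelled. *)
have Su : Q^T *m Q \in unitmx.
  by rewrite -(@unitmxZ _ _ a^-1) ?unitfE ?invr_eq0// (near_identity_unitmx kd SI').
rewrite mxE [X in _ + X]mxE; apply: le_trans de.
apply: (near_identity_solution_close kd SI' (g := g)) => [i|]; first by rewrite gE.
by rewrite /S /g -scalemxAl -(mulmxA (invmx _)) mulKVmx.
Qed.

(** * Consistency of the OLS coefficient for the gradient of the objective *)

Unset Implicit Arguments.

Theorem theorem1 (R : realType) (k dx dt : nat)
  (w : 'rV[R]_dx -> 'rV[R]_k -> R) (x : 'rV[R]_k -> 'rV[R]_dt -> 'rV[R]_dx)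
  (y : R -> 'rV[R]_dt -> R) (piF : R -> R -> R)
  (* continuous differentiability of w, x, y, pi (jointly in their arguments) *)
  (Cw : C1 (fun p : 'rV[R]_dx * 'rV[R]_k => w p.1 p.2))
  (Cx : C1 (fun p : 'rV[R]_k * 'rV[R]_dt => x p.1 p.2))
  (Cy : C1 (fun p : R^o * 'rV[R]_dt => y p.1 p.2))
  (Cpi : C1 (fun p : R^o * R^o => piF p.1 p.2))
  (* probability space, types theta_i and sign vectors eps_i *)
  (d : measure_display) (Omega : measurableType d) (P : probability Omega R)
  (theta : nat -> Omega -> 'rV[R]_dt) (eps : nat -> Omega -> signs k)
  (theta_meas : forall i j, measurable_fun setT (fun om => theta i om 0 j))
  (eps_meas : forall i (s : signs k), measurable (eps i @^-1` [set s]))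
  (* theta_i identically distributed (common law G = law of theta 0) *)
  (theta_id : forall i (A : 'I_dt -> set R), (forall j, measurable (A j)) ->
     P (in_box (theta i) A) = P (in_box (theta 0%N) A))
  (* theta is a continuous random variable: G has no atoms *)
  (theta_cont : forall t : 'rV[R]_dt, P [set om | theta 0%N om = t] = 0%E)
  (* eps_i uniform on {-1,1}^k *)
  (eps_unif : forall i (s : signs k),
     P (eps i @^-1` [set s]) = ((2 ^ k)%:R^-1)%:E)
  (* all theta_i, eps_i mutually independent *)
  (Hindep : indep_family P theta eps)
  (betahat : 'rV[R]_k)
  (* implicit regularity: bounded second moment of pi near betahat, and
     Pi differentiable at betahat (so that grad Pi (betahat) exists) *)
  (Hmom : exists r : R, exists M : R, 0 < r /\
     forall beta : 'rV[R]_k, `|beta - betahat| < r ->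
       (\int[P]_om ((pobj w x y piF beta (theta 0%N om)) ^+ 2)%:E <= M%:E)%E)
  (Hdiff : differentiable (Pi P w x y piF (theta 0%N)) betahat)
  (c alpha : R) (c_gt0 : 0 < c) (alpha_gt0 : 0 < alpha) (alpha_lt : alpha < 1 / 2)
  (e : R) (e_gt0 : 0 < e) :
  let h (n : nat) : R := c * powR (n%:R) (- alpha) in
  let Q (n : nat) (om : Omega) : 'M[R]_(n, k) :=
    \matrix_(i < n, j < k) (h n * sgnvec R (eps i om) 0 j) in
  let piv (n : nat) (om : Omega) : 'cV[R]_n :=
    \col_(i < n) pobj w x y piF (betahat + h n *: sgnvec R (eps i om)) (theta i om) in
  let Gamma (n : nat) (om : Omega) : 'cV[R]_k :=
    invmx ((Q n om)^T *m Q n om) *m (Q n om)^T *m piv n om in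
  (fun n : nat => fine (P [set om |
      euclid (Gamma n om - grad (Pi P w x y piF (theta 0%N)) betahat) > e]))
    @ \oo --> (0 : R).
Proof.
move=> h Q piv Gamma.
have [r [M [r0 HM]]] := Hmom.
set Pib := Pi P w x y piF (theta 0%N) in Hdiff *.
pose t := grad Pib betahat.
(* [f] and [q] are the summands of the entries of [Q'pi / (n h^2)] and [Q'Q / (n h^2)]; one factor
   [h] of [Q] cancels in [f], both in [q]. *)
pose f n j : obs R k dt -> R := fun z =>
  sgnvec R z.2 0 j / h n * pobj w x y piF (betahat + h n *: sgnvec R z.2) z.1.
pose q j l : obs R k dt -> R := fun z => sgnvec R z.2 0 j * sgnvec R z.2 0 l.
have cpobj b : continuous (pobj w x y piF b) by exact: continuous_pobj.
have cf n j s : continuous (fun v => f n j (v, s)).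
  move=> v; rewrite /f/=; apply: cvgMr; first exact: nbhs_filter.
  exact: (@cpobj (betahat + h n *: sgnvec R s) v).
have cq j l s : continuous (fun v => q j l (v, s)) by move=> v; apply: cst_continuous.
have mpobj b i : measurable_fun setT (fun om => pobj w x y piF b (theta i om)).
  exact: (measurable_continuous_rV (@cpobj b) (theta_meas i)).
have h_gt0 n : (0 < n)%N -> 0 < h n by move=> n0; rewrite mulr_gt0// powR_gt0// ltr0n.
have hr n s : (0 < n)%N -> h n < r -> `|betahat + h n *: sgnvec R s - betahat| < r.
  move=> n0 hr; rewrite addrAC subrr add0r normrZ gtr0_norm ?h_gt0//.
  by rewrite (le_lt_trans _ hr)// ger_pMr ?h_gt0// sgnvec_normmx.
(* The factor [1 / h] in [f] costs [1 / h^2] in the second moment, which is why [n h^2] governs the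
   rate. *)
have f2 n j s : (0 < n)%N -> h n < r ->
    (\int[P]_om (f n j (theta 0%N om, s) ^+ 2)%:E <= (M / h n ^+ 2)%:E)%E.
  move=> n0 hnr; have := HM _ (hr n s n0 hnr).
  rewrite [in X in _ -> X](_ : (fun om => (f n j (theta 0%N om, s) ^+ 2)%:E) =
    fun om => ((h n ^- 2)%:E *
      (pobj w x y piF (betahat + h n *: sgnvec R s) (theta 0%N om) ^+ 2)%:E)%E); last first.
    apply/funext => om; rewrite /f/= -EFinM; move: (h n) => hn.
    by rewrite !exprMn (expr2 (sgnvec R s 0 j)) sgnvec_sqr mul1r exprVn.
  rewrite ge0_integralZl_EFin//.
  - move=> le; rewrite mulrC EFinM; apply: lee_wpmul2l => //.
    by rewrite lee_fin invr_ge0 sqr_ge0.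
  - by move=> om _; rewrite lee_fin sqr_ge0.
  - by apply/measurable_EFinP; apply: measurable_funX; exact: mpobj.
  - by rewrite invr_ge0 sqr_ge0.
have q2 j l s : (\int[P]_om (q j l (theta 0%N om, s) ^+ 2)%:E <= 1%:E)%E.
  rewrite [X in (\int[P]_om X om)%E](_ : _ = cst 1%:E); last first.
    by apply/funext => om; rewrite /q/= exprMn !expr2 !sgnvec_sqr mulr1.
  by rewrite integral_cst//= probability_setT mule1.
(* The moment bound makes the objective integrable, so the factor [s_j / h] leaves the integral and
   [Pi] appears. *)
have fmean n j : (0 < n)%N -> h n < r ->
    (2 ^ k)%:R^-1 * (\sum_(s : signs k) fine (\int[P]_om (f n j (theta 0%N om, s))%:E)) =
    (2 ^ k)%:R^-1 * (\sum_s (sgnvec R s 0 j / h n) * Pib (betahat + h n *: sgnvec R s)).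
  move=> n0 hnr; congr (_ * _); apply: eq_bigr => s _; rewrite /f/= /Pib /Pi.
  set b := betahat + _.
  have b2 : (fun om => pobj w x y piF b (theta 0%N om)) \in Lfun P 2%:E.
    by apply: sqr_integrable_Lfun2 => //; exact: le_lt_trans (HM _ (hr n s n0 hnr)) (ltry _).
  have /Lfun1_integrable ib :=
    Lfun_subset12 (fin_num_measure P _ measurableT) b2.
  under eq_integral do rewrite EFinM.
  rewrite integralZl//= fineM//; exact: integrable_fin_num.
have qmean j l :
    (2 ^ k)%:R^-1 * (\sum_(s : signs k) fine (\int[P]_om (q j l (theta 0%N om, s))%:E)) =
    (j == l)%:R.
  under eq_bigr do rewrite /q/= integral_cst//= probability_setT mule1/=.
  by rewrite sum_sgnvecM mulrA mulVf ?mul1r// pnatr_eq0 expn_eq0.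
pose T := \sum_l `|t l 0|.
have T0 : 0 <= T by apply: sumr_ge0.
have T1 : 0 < 2 * (1 + T) by rewrite mulr_gt0// ltr_pwDl.
(* The first term makes the solution error at most [e / (k + 1)], as [euclid_le] needs; the second
   gives [k * delta <= 1 / 2]. *)
pose delta := Num.min (e / k.+1%:R / (2 * (1 + T))) ((2 * k.+1%:R)^-1).
have delta0 : 0 < delta.
  by rewrite lt_min divr_gt0 ?divr_gt0//= invr_gt0 mulr_gt0.
have kdelta : k%:R * delta <= 2^-1.
  have k1 : 0 < k.+1%:R :> R by [].
  apply: (@le_trans _ _ (k.+1%:R * delta)).
    by rewrite ler_wpM2r ?ler_nat ?ltW.
  by rewrite -ler_pdivlMl// -invfM mulrC ge_min lexx orbT.
have edelta : 2 * (delta * (1 + T)) <= e / k.+1%:R.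
  by rewrite mulrCA mulrA -[leLHS]mulrA -ler_pdivlMr// ge_min lexx.
(* Half of [delta] is kept for the bias of the difference quotients. The entries in [B] have exact
   means, so there the whole [delta] is available. *)
pose A n j : set Omega := [set om |
  delta / 2 <= `|n%:R^-1 * (\sum_(i < n) f n j (sample theta eps i om)) -
    (2 ^ k)%:R^-1 * \sum_(s : signs k) fine (\int[P]_om (f n j (theta 0%N om, s))%:E)|].
pose B n (jl : 'I_k * 'I_k) : set Omega := [set om |
  delta <= `|n%:R^-1 * (\sum_(i < n) q jl.1 jl.2 (sample theta eps i om)) -
    (2 ^ k)%:R^-1 *
      \sum_(s : signs k) fine (\int[P]_om (q jl.1 jl.2 (theta 0%N om, s))%:E)|].
have mdev (g : Omega -> R) a b : measurable_fun setT g -> measurable [set om | a <= `|g om - b|].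
  move=> mg; have mg' : measurable_fun setT (fun om => `|g om - b|).
    by apply: measurableT_comp => //; exact: measurable_funB.
  have := mg' measurableT _ (measurable_itv `[a, +oo[).
  by rewrite setTI; congr measurable; apply/seteqP; split => om /=;
    rewrite in_itv/= andbT.
have mA n j : measurable (A n j).
  by apply: mdev; apply: measurable_funM => //; exact: measurable_sample_average.
have mB n jl : measurable (B n jl).
  by apply: mdev; apply: measurable_funM => //; exact: measurable_sample_average.
(* With the sign patterns fixed, the estimator is a constant matrix applied to the measurable
   outcomes. *)
have mE n : measurable [set om | euclid (Gamma n om - t) > e].
  pose Qp (p : {ffun 'I_n -> signs k}) : 'M[R]_(n, k) :=
    \matrix_(i < n, j < k) (h n * sgnvec R (p i) 0 j).
  pose pp (p : {ffun 'I_n -> signs k}) om : 'cV[R]_n :=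
    \col_(i < n) pobj w x y piF (betahat + h n *: sgnvec R (p i)) (theta i om).
  pose E p := [set om | e < euclid (invmx ((Qp p)^T *m Qp p) *m (Qp p)^T *m pp p om - t)].
  have -> : [set om | euclid (Gamma n om - t) > e] =
      [set om | E [ffun i : 'I_n => eps i om] om].
    apply: eq_set => om; rewrite /E/=.
    have -> : Qp [ffun i : 'I_n => eps i om] = Q n om.
      by apply/matrixP => i j; rewrite !mxE ffunE.
    have -> // : pp [ffun i : 'I_n => eps i om] om = piv n om.
    by apply/matrixP => i j; rewrite !mxE ffunE.
  apply: measurable_sign_pattern => // p; apply: measurable_euclid_gt => j.
  apply: (eq_measurable_fun (fun om =>
    \sum_(i < n) (invmx ((Qp p)^T *m Qp p) *m (Qp p)^T) j i *
      pobj w x y piF (betahat + h n *: sgnvec R (p i)) (theta i om) - t j 0)).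
    move=> om _; rewrite [RHS]mxE [X in _ = _ + X]mxE; congr (_ - _).
    by rewrite [RHS]mxE; apply: eq_bigr => i _; rewrite [X in _ = _ * X]mxE.
  apply: measurable_funB => //; apply: measurable_sum => i.
  by apply: measurable_funM => //; exact: mpobj.
have bias j : \forall n \near \oo,
    `|(2 ^ k)%:R^-1 * (\sum_s (sgnvec R s 0 j / h n) * Pib (betahat + h n *: sgnvec R s))
      - t j 0| <= delta / 2.
  have h_near : \forall n \near \oo, h n != 0.
    by near=> n; rewrite gt_eqF// h_gt0//; near: n; exact: nbhs_infty_gt.
  have := @sign_average_cvg R k Pib betahat h j Hdiff (@step_size_cvg0 R c alpha alpha_gt0) h_near.
  move=> /cvgrPdist_le /(_ (delta / 2)); rewrite divr_gt0// => /(_ isT).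
  by apply: filterS => n; rewrite distrC /t mxE.
have biasall : \forall n \near \oo, forall j,
    `|(2 ^ k)%:R^-1 * (\sum_s (sgnvec R s 0 j / h n) * Pib (betahat + h n *: sgnvec R s))
      - t j 0| <= delta / 2.
  exact: filter_forall.
have h_small : \forall n \near \oo, h n < r.
  have := @step_size_cvg0 R c alpha alpha_gt0.
  move=> /cvgr0_norm_lt /(_ r r0); apply: filterS => n.
  exact: le_lt_trans (ler_norm _).
(* [K1] adds up the Chebyshev bounds of the [k] events [A], without the factor [1 / (n h^2)]; [K2]
   those of the [k * k] events [B], without [1 / n]. *)
pose K1 : R := k%:R * ((2 ^ k)%:R * M / (delta / 2) ^+ 2).
pose K2 : R := (k * k)%:R * ((2 ^ k)%:R / delta ^+ 2).
apply: (@squeeze_cvgr _ _ _ _ (fun=> 0)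
  (fun n => K1 * (n%:R * h n ^+ 2)^-1 + K2 * n%:R^-1)); last 2 first.
- exact: cvg_cst.
- rewrite -[X in _ --> X]addr0 -[X in _ --> X + _](mulr0 K1) -[X in _ --> _ + X](mulr0 K2).
  apply: cvgD; apply: cvgMr; first exact: effective_sample_size_cvg.
  apply/(@gtr0_cvgV0 R _ _ _ (fun n : nat => n%:R)); last exact: cvgr_idn.
  by near=> n; rewrite ltr0n; near: n; exact: nbhs_infty_gt.
near=> n.
have n0 : (0 < n)%N by near: n; exact: nbhs_infty_gt.
have hnr : h n < r by near: n.
have biasn : forall j,
    `|(2 ^ k)%:R^-1 * (\sum_s (sgnvec R s 0 j / h n) * Pib (betahat + h n *: sgnvec R s))
      - t j 0| <= delta / 2 by near: n.
rewrite fine_ge0//= -lee_fin fineK ?fin_num_measure//.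
(* Outside all deviation events the hypotheses of [ols_close] hold, so the error is at most [e]. *)
have sub : [set om | euclid (Gamma n om - t) > e] `<=`
    (\big[setU/set0]_j A n j) `|` (\big[setU/set0]_jl B n jl).
  move=> om /= eom; apply: contrapT => nAB.
  have nA j : ~ A n j om.
    by move=> Aj; apply: nAB; left; rewrite -bigcup_seq; exists j => //=; rewrite mem_index_enum.
  have nB jl : ~ B n jl om.
    by move=> Bj; apply: nAB; right; rewrite -bigcup_seq; exists jl => //=; rewrite mem_index_enum.
  move: eom; apply/negP; rewrite -leNgt.
  apply: (@ols_close R k n (h n) delta e (fun i => eps i om)) => //.
  - exact: h_gt0.
  - exact: ltW.
  - move=> j l; have /negP := nB (j, l); rewrite -ltNge /= qmean => /ltW.
    by [].
  - move=> j; have /negP := nA j; rewrite -ltNge fmean// => /ltW fj.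
    have := biasn j.
    set m := (2 ^ k)%:R^-1 * _ in fj * => mj.
    (* Pass through the mean [m]: sampling error and bias are each at most [delta / 2]. *)
    rewrite -(subrK m (_ * _)) -addrA (le_trans (ler_normD _ _))//.
    rewrite (splitr delta) lerD//; apply: le_trans fj.
    rewrite le_eqVlt; apply/orP; left; apply/eqP; congr (`|_ * _ - _|).
    by apply: eq_bigr => i _; rewrite [piv n om i 0]mxE.
apply: (@le_trans _ _ (P ((\big[setU/set0]_j A n j) `|` (\big[setU/set0]_jl B n jl)))).
  apply: le_measure => //; rewrite ?inE//.
  by apply: measurableU; apply: bigsetU_measurable.
apply: (le_trans (measureU2 P _ _)); [exact: bigsetU_measurable..|].
rewrite EFinD leeD//; apply: (le_trans (measure_bigsetU_le P _ _)) => //.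
- apply: (@le_trans _ _ (\sum_(j < k)
      ((2 ^ k)%:R * (M / h n ^+ 2) / (n%:R * (delta / 2) ^+ 2))%:E)%E).
    apply: lee_sum => j _; apply: sample_average_deviation => //.
    + by move=> s; exact: f2.
    + by rewrite divr_gt0.
  rewrite sumEFin lee_fin sumr_const card_ord /K1 -[leLHS]mulr_natl.
  rewrite le_eqVlt; apply/orP; left; apply/eqP; field.
  by rewrite !gt_eqF ?h_gt0 ?ltr0n.
- apply: (@le_trans _ _ (\sum_(jl : 'I_k * 'I_k)
      ((2 ^ k)%:R * 1 / (n%:R * delta ^+ 2))%:E)%E).
    by apply: lee_sum => jl _; apply: sample_average_deviation.
  rewrite sumEFin lee_fin sumr_const card_prod card_ord /K2 -[leLHS]mulr_natl.
  rewrite le_eqVlt; apply/orP; left; apply/eqP; field.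
  by rewrite !gt_eqF ?ltr0n.
Unshelve. all: by end_near. Qed.
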